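(* Let $n$ and $k_1,\dots,k_s$ ($1\le s\le n$) be natural numbers and let $m\ge 0$ be an integer. Let $h_j(s)$ be the coefficient of $t^j$ in the power series expansion of $(1-t^{k_1})\cdots(1-t^{k_s})(1-t)^{-n}$. Then $$h_m(s)=e_m^{(n)}(k_1,\dots,k_s)-e_{m-1}^{(n)}(k_1,\dots,k_s),$$ and the number $H_m(s)=\sum_{j=0}^m h_j(s)$ (the upper bound for the dimension of $\mathbb{P}_m^{(n)}$ along an algebraic manifold which is the sufficient intersection of $s$ hypersurfaces of degrees $k_1,\dots,k_s$) satisfies $$H_m(s)=\sum_{j=0}^m h_j(s)=e_m^{(n)}(k_1,\dots,k_s).$$
   Context: For every integer $m$, $e_m^{(n)}=\binom{m+n}{n}$, with the convention $\binom{a}{n}=0$ for every integer $a<n$ (so $e_m^{(n)}=0$ for $m<0$). The backward difference operator $\nabla_k$ acts on sequences indexed by $m\in\mathbb{Z}$ by $\nabla_k u_m=u_m-u_{m-k}$, and $e_m^{(n)}(k_1,\dots,k_s)=\nabla_{k_s}\cdots\nabla_{k_2}\nabla_{k_1}e_m^{(n)}$; for instance $e_m^{(n)}(k_1)=e_m^{(n)}-e_{m-k_1}^{(n)}$. $\mathbb{P}_m^{(n)}$ is the space of complex polynomials in $n$ variables of total degree $\le m$. *)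

(* Defs.v *)
From HB Require Import structures.
From mathcomp Require Import all_boot all_order all_algebra.
From mathcomp Require Import boolp.

Set Implicit Arguments.
Unset Strict Implicit.
Unset Printing Implicit Defensive.

Import Order.TTheory GRing.Theory Num.Theory.
Local Open Scope ring_scope.

(* Formal power series in one variable over R, as coefficient sequences.      *)
(* The record keeps the Cauchy product apart from the pointwise product that  *)
(* functions nat -> R carry.                                                  *)
Record fps (R : Type) := Fps { fcoef : nat -> R }.

HB.instance Definition _ (R : Type) := gen_eqMixin (fps R).
HB.instance Definition _ (R : Type) := gen_choiceMixin (fps R).

Section FpsRing.
Variable R : comUnitRingType.
Implicit Types a b c : fps R.

Lemma fpsP a b : fcoef a =1 fcoef b -> a = b.
Proof. by case: a b => [a] [b] /= /funext ->. Qed.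

Definition fps_zero : fps R := Fps (fun=> 0).
Definition fps_opp a : fps R := Fps (fun j => - fcoef a j).
Definition fps_add a b : fps R := Fps (fun j => fcoef a j + fcoef b j).
Definition fps_one : fps R := Fps (fun j => (j == 0%N)%:R).
Definition fps_mul a b : fps R :=
  Fps (fun j => \sum_(i < j.+1) fcoef a i * fcoef b (j - i)).

Lemma fps_addA : associative fps_add.
Proof. by move=> a b c; apply: fpsP => j /=; rewrite addrA. Qed.
Lemma fps_addC : commutative fps_add.
Proof. by move=> a b; apply: fpsP => j /=; rewrite addrC. Qed.
Lemma fps_add0 : left_id fps_zero fps_add.
Proof. by move=> a; apply: fpsP => j /=; rewrite add0r. Qed.
Lemma fps_addN : left_inverse fps_zero fps_opp fps_add.
Proof. by move=> a; apply: fpsP => j /=; rewrite addNr. Qed.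

HB.instance Definition _ :=
  GRing.isZmodule.Build (fps R) fps_addA fps_addC fps_add0 fps_addN.

Let trunc n a : {poly R} := \poly_(i < n) fcoef a i.

Let fcoef_mul n a b j : (j < n)%N ->
  fcoef (fps_mul a b) j = (trunc n a * trunc n b)`_j.
Proof.
move=> jn; rewrite coefM; apply: eq_bigr => i _; rewrite !coef_poly.
by rewrite !(leq_ltn_trans _ jn) ?leq_subr // -ltnS.
Qed.

Lemma fps_mulC : commutative fps_mul.
Proof.
by move=> a b; apply: fpsP => j; rewrite !(@fcoef_mul j.+1) // mulrC.
Qed.

Lemma fps_mulA : associative fps_mul.
Proof.
move=> a b c; apply: fpsP => j.
transitivity (trunc j.+1 a * trunc j.+1 b * trunc j.+1 c)`_j.
  rewrite -mulrA coefM; apply: eq_bigr => i _.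
  rewrite coef_poly ltn_ord; congr (_ * _).
  by rewrite (@fcoef_mul j.+1) // ltnS leq_subr.
rewrite coefM; apply: eq_bigr => i _.
rewrite [X in _ * X]coef_poly ltnS leq_subr; congr (_ * _).
by rewrite (@fcoef_mul j.+1).
Qed.

Lemma fps_mul1 : left_id fps_one fps_mul.
Proof.
move=> a; apply: fpsP => j /=; rewrite big_ord_recl mul1r subn0.
by rewrite big1 ?addr0 // => i _; rewrite mul0r.
Qed.

Lemma fps_mulDl : left_distributive fps_mul fps_add.
Proof.
move=> a b c; apply: fpsP => j /=; rewrite -big_split.
by apply: eq_bigr => i _; rewrite mulrDl.
Qed.

Lemma fps_oner_neq0 : fps_one != 0.
Proof.
by apply/eqP => /(congr1 (fun a => fcoef a 0)) /eqP; rewrite oner_eq0.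
Qed.

HB.instance Definition _ := GRing.Zmodule_isComNzRing.Build (fps R)
  fps_mulA fps_mulC fps_mul1 fps_mulDl fps_oner_neq0.

(* The first j.+1 coefficients of a^-1, from the recursion                    *)
(* b_j = - a_0^-1 * (a_j b_0 + ... + a_1 b_(j-1)).                            *)
Fixpoint fps_inv_seq a j : seq R :=
  if j is j'.+1 then
    let s := fps_inv_seq a j' in
    rcons s (- (fcoef a 0)^-1 * \sum_(i < j) fcoef a (j - i) * s`_i)
  else [:: (fcoef a 0)^-1].

Definition fps_unit : pred (fps R) := fun a => fcoef a 0 \is a GRing.unit.

Definition fps_inv a : fps R :=
  if fps_unit a then Fps (fun j => (fps_inv_seq a j)`_j) else a.

Let size_fps_inv_seq a j : size (fps_inv_seq a j) = j.+1.
Proof. by elim: j => //= j IH; rewrite size_rcons IH. Qed.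

Let nth_fps_inv_seq a i j : (i <= j)%N ->
  (fps_inv_seq a j)`_i = (fps_inv_seq a i)`_i.
Proof.
elim: j => [|j IH]; first by rewrite leqn0 => /eqP ->.
rewrite leq_eqVlt => /predU1P [-> //|ij].
by rewrite /= nth_rcons size_fps_inv_seq ij IH.
Qed.

Lemma fps_mulVr : {in fps_unit, left_inverse 1 fps_inv *%R}.
Proof.
move=> a ua; rewrite /fps_inv; have ua' : fps_unit a := ua.
rewrite ua'; apply: fpsP => -[|j].
  by rewrite [LHS]big_ord_recl big_ord0 addr0 /= mulVr.
rewrite [LHS]big_ord_recr subnn /= nth_rcons size_fps_inv_seq ltnn eqxx.
rewrite mulNr mulNr mulrAC mulVr // mul1r; apply/eqP; rewrite subr_eq0.
apply/eqP/eq_bigr => i _.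
by rewrite mulrC (@nth_fps_inv_seq a i j) // -ltnS.
Qed.

Lemma fps_unitPl a b : b * a = 1 -> fps_unit a.
Proof.
move=> /(congr1 (fun c => fcoef c 0)).
rewrite [LHS]big_ord_recl big_ord0 addr0 /= => ba.
by apply/unitrPr; exists (fcoef b 0); rewrite mulrC.
Qed.

Lemma fps_inv_out : {in [predC fps_unit], fps_inv =1 id}.
Proof.
by move=> a; rewrite inE /= /fps_inv => na; rewrite (negbTE (na : ~~ fps_unit a)).
Qed.

HB.instance Definition _ := GRing.ComNzRing_hasMulInverse.Build (fps R)
  fps_mulVr fps_unitPl fps_inv_out.

Definition fpsX : fps R := Fps (fun j => (j == 1%N)%:R).

End FpsRing.

Arguments fpsX {R}.

(* binom(a, n) for an integer upper argument, with the convention that it is  *)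
(* 0 for every a < n, negative a included.                                    *)
Definition binz (a : int) (n : nat) : int :=
  if a < n%:Z then 0 else 'C(`|a|%N, n)%:Z.

Definition e_seq (n : nat) (m : int) : int := binz (m + n%:Z) n.

Definition nabla (k : nat) (u : int -> int) : int -> int :=
  fun m => u m - u (m - k%:Z).

(* nabla_{k_s} ... nabla_{k_1} e^(n): the head k_1 of ks is applied first.    *)
Definition e_nabla (n : nat) (ks : seq nat) : int -> int :=
  foldl (fun u k => nabla k u) (e_seq n) ks.

Definition h_series (n : nat) (ks : seq nat) : fps int :=
  (\prod_(k <- ks) (1 - fpsX ^+ k)) * (1 - fpsX) ^- n.

Definition h_coef (n : nat) (ks : seq nat) (j : nat) : int :=
  fcoef (h_series n ks) j.

Definition H_sum (n : nat) (ks : seq nat) (m : nat) : int :=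
  \sum_(0 <= j < m.+1) h_coef n ks j.

(* 1 - t is invertible, so (1 - t)^-n is a genuine inverse rather than the    *)
(* default value that inversion takes on non-units.                           *)
Lemma fps_1subX_unit : (1 - fpsX : fps int) \is a GRing.unit.
Proof. by []. Qed.

(* Main.v *)
Require Import Defs.
From mathcomp Require Import all_boot all_order all_algebra.
From mathcomp Require Import zify.

Set Implicit Arguments.
Unset Strict Implicit.
Unset Printing Implicit Defensive.

Import GRing.Theory.
Local Open Scope ring_scope.

(** Encode a sequence indexed by the integers and vanishing at negative indices
    by its generating series. The backward difference [nabla k] then becomes
    multiplication by [1 - t^k] ([nabla_bilateral]). Pascal's rule says that
    the first difference of [m |-> binom(m + n + 1, n + 1)] is
    [m |-> binom(m + n, n)], so [e_seq n] is encoded by [(1 - t)^-(n + 1)]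
    ([e_seq_bilateral]). Hence [e_nabla n ks] is encoded by
      [E = (1 - t^k_1) ... (1 - t^k_s) (1 - t)^-(n + 1)]
    ([e_nabla_bilateral]), while the series defining [h_coef] is [(1 - t) E].
    Reading the coefficient of [t^m] in the latter gives the first identity.
    Summing it over [0 <= j <= m] telescopes, and the remaining boundary term
    is the value of [e_nabla n ks] at [-1], which is zero. *)

Lemma fcoef_mulX (R : comUnitRingType) (b : fps R) j :
  fcoef (fpsX * b) j = if j is i.+1 then fcoef b i else 0.
Proof.
case: j b => [|j] [b]; rewrite /= big_ord_recl mul0r ?big_ord0 ?addr0 //.
rewrite big_ord_recl mul1r add0r big1 ?addr0 => [|i _]; last by rewrite mul0r.
by rewrite subSS subn0.
Qed.

Lemma fcoef_mulXn (R : comUnitRingType) (a : fps R) k j :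
  fcoef (fpsX ^+ k * a) j = if (k <= j)%N then fcoef a (j - k)%N else 0.
Proof.
elim: k j => [|k IH] j; first by rewrite expr0 mul1r subn0.
by rewrite exprS -mulrA fcoef_mulX; case: j.
Qed.

(** Zero at negative indices, so that [a] is the generating series. *)
Definition bilateral (a : fps int) (m : int) : int :=
  if m is Posz j then fcoef a j else 0.

(** Multiplication by [t^k] shifts coefficients by [k], and the zeros at negative
    indices are what the shift brings in at the first [k] places. *)
Lemma nabla_bilateral k a :
  nabla k (bilateral a) =1 bilateral ((1 - fpsX ^+ k) * a).
Proof.
have coefE j : fcoef ((1 - fpsX ^+ k) * a) j
             = fcoef a j - (if (k <= j)%N then fcoef a (j - k)%N else 0).
  by rewrite mulrBl mul1r -fcoef_mulXn.
case=> j; rewrite /nabla.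
  rewrite -[RHS]/(fcoef ((1 - fpsX ^+ k) * a) j) coefE.
  case: leqP => kj; first by rewrite subzn.
  by case E: (j%:Z - k%:Z) => [i|i] //; exfalso; lia.
by case E: (Negz j - k%:Z) => [i|i]; rewrite ?subr0 //; exfalso; lia.
Qed.

Lemma nabla1_bilateral a :
  nabla 1 (bilateral a) =1 bilateral ((1 - fpsX) * a).
Proof. by move=> m; rewrite nabla_bilateral expr1. Qed.

(** Lets identities between series be checked as identities between
    differences. *)
Lemma bilateral_inj a b : bilateral a =1 bilateral b -> a = b.
Proof. by move=> ab; apply: fpsP => j; apply: (ab j%:Z). Qed.

Lemma PoszS_sub1 (j : nat) : j.+1%:Z - 1%:Z = j%:Z.
Proof. by rewrite subzn // subn1. Qed.

Definition binom_series (n : nat) : fps int :=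
  Fps (fun j => 'C((j + n)%N, n)%:Z).

Lemma e_seq_binom_series n : e_seq n =1 bilateral (binom_series n).
Proof.
case=> j; rewrite /e_seq /binz /=; first by rewrite ifF //; lia.
by rewrite ifT //; lia.
Qed.

(** Pascal's rule; the convention that binomials vanish at negative [m] makes it
    hold also at [m = 0], where it reads [1 - 0 = 1]. *)
Lemma nabla1_e_seq n : nabla 1 (e_seq n.+1) =1 e_seq n.
Proof.
move=> m; rewrite /nabla !e_seq_binom_series.
case: m => [[|j]|j] //; first by rewrite /= !add0n !binn.
by rewrite PoszS_sub1 /= addSn binS addnS addSn PoszD addrAC subrr add0r.
Qed.

(** The negative binomial series, by induction on [n]: multiplying
    [binom_series n.+1] by [1 - t] gives [binom_series n], by Pascal's rule. *)
Lemma binom_series_inv n : (1 - fpsX) ^- n.+1 = binom_series n.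
Proof.
suff E: (1 - fpsX) ^+ n.+1 * binom_series n = 1.
  by apply: (mulrI (unitrX n.+1 fps_1subX_unit)); rewrite mulrV ?E // unitrX.
elim: n => [|n IH].
  apply: bilateral_inj => m; rewrite expr1 -nabla1_bilateral /nabla.
  by case: m => [[|j]|j] //; rewrite ?PoszS_sub1 /= ?bin0.
rewrite exprSr -mulrA -[RHS]IH; congr (_ * _).
apply: bilateral_inj => m.
rewrite -nabla1_bilateral -e_seq_binom_series.
by rewrite -nabla1_e_seq /nabla !e_seq_binom_series.
Qed.

Lemma e_seq_bilateral n : e_seq n =1 bilateral ((1 - fpsX) ^- n.+1).
Proof. by move=> m; rewrite e_seq_binom_series binom_series_inv. Qed.

(** Stated for arbitrary [u] and [a], because [foldl] changes its starting
    sequence at each step of the induction. *)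
Lemma foldl_nabla_bilateral ks u a : u =1 bilateral a ->
  foldl (fun v k => nabla k v) u ks
    =1 bilateral (\prod_(k <- ks) (1 - fpsX ^+ k) * a).
Proof.
elim: ks u a => [|k ks IH] u a ua; first by rewrite big_nil mul1r.
rewrite big_cons [_ * \prod_(_ <- _) _]mulrC -mulrA; apply: IH => m.
by rewrite -nabla_bilateral /nabla !ua.
Qed.

Lemma e_nabla_bilateral n ks :
  e_nabla n ks =1
    bilateral (\prod_(k <- ks) (1 - fpsX ^+ k) * (1 - fpsX) ^- n.+1).
Proof. exact/foldl_nabla_bilateral/e_seq_bilateral. Qed.

Lemma h_coef_nabla n ks m :
  h_coef n ks m = e_nabla n ks m%:Z - e_nabla n ks (m%:Z - 1).
Proof.
(* one factor 1 - t cancels against the exponent n + 1 *)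
have hE: h_series n ks =
  (1 - fpsX) * (\prod_(k <- ks) (1 - fpsX ^+ k) * (1 - fpsX) ^- n.+1).
  rewrite mulrCA; congr (_ * _).
  by rewrite exprS invrM ?unitrX ?fps_1subX_unit // mulrCA mulrV ?mulr1.
rewrite !e_nabla_bilateral -[LHS]/(bilateral (h_series n ks) m%:Z) hE.
by rewrite -nabla1_bilateral.
Qed.

Lemma H_sum_e_nabla n ks m : H_sum n ks m = e_nabla n ks m%:Z.
Proof.
rewrite /H_sum; elim: m => [|m IH].
  (* the boundary term is the value at -1 *)
  by rewrite big_nat1 h_coef_nabla [X in _ - X]e_nabla_bilateral subr0.
rewrite big_nat_recr //= IH h_coef_nabla PoszS_sub1.
by rewrite addrC subrK.
Qed.

Theorem proposition2p3 (n s : nat) (k : s.-tuple nat) (m : nat)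
    (hs1 : (1 <= s)%N) (hsn : (s <= n)%N) :
  h_coef n k m = (e_nabla n k m%:Z - e_nabla n k (m%:Z - 1))%R
  /\ H_sum n k m = e_nabla n k m%:Z.
Proof. by split; [apply: h_coef_nabla | apply: H_sum_e_nabla]. Qed.
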